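(* Let $A$ be a magic square of order $2n$ with magic number $\mu$, and suppose that for some MCPM $P$ of order $2n$ at least one of the following holds: $$A+PA=\frac{2\mu}{2n}E\qquad\text{or}\qquad A+AP=\frac{2\mu}{2n}E,$$ where $E$ is the $2n\times 2n$ all-ones matrix. Then $A$ is singular. Furthermore, the rank of $A$ is at most $n+1$.
   Context: For a positive integer $m$, let $e_1,\dots,e_m$ be the standard basis column vectors of $\mathbb{R}^m$, $e\in\mathbb{R}^m$ the all-ones column vector, and $J$ the $m\times m$ reverse matrix, with $J_{i,j}=1$ if $i+j=m+1$ and $J_{i,j}=0$ otherwise. A magic square of order $m$ with magic number $\mu$ is a real $m\times m$ matrix $A$ with $e_i^TAe=\mu$ for all $i$, $e^TAe_j=\mu$ for all $j$, $\operatorname{tr}(A)=\mu$ and $\operatorname{tr}(JA)=\mu$. A magic classifying permutation matrix (MCPM) of even order $m$ is a symmetric $m\times m$ permutation matrix $P$ with $\operatorname{tr}(P)=0$. *)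

(* Defs.v *)
From mathcomp Require Import all_boot all_order all_algebra all_fingroup.
From mathcomp Require Import reals.

Set Implicit Arguments.
Unset Strict Implicit.
Unset Printing Implicit Defensive.

Import GRing.Theory.
Local Open Scope ring_scope.

(* Ordinals are 0-based, so the 1-based condition i + j = m + 1 becomes
   i + j + 1 = m. *)
Definition reverse_mx (R : realType) (m : nat) : 'M[R]_m :=
  \matrix_(i, j) ((i + j).+1 == m)%:R.

Definition ones_col (R : realType) (m : nat) : 'cV[R]_m := const_mx 1.

Definition basis_col (R : realType) (m : nat) (i : 'I_m) : 'cV[R]_m :=
  delta_mx i 0.

(* In the first two clauses the products are 1 x 1 matrices; they are compared
   with mu through their unique entry. *)
Definition magic_square (R : realType) (m : nat) (mu : R) (A : 'M[R]_m) : Prop :=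
  [/\ forall i : 'I_m, ((basis_col R i)^T *m A *m ones_col R m) 0 0 = mu,
      forall j : 'I_m, ((ones_col R m)^T *m A *m basis_col R j) 0 0 = mu,
      \tr A = mu
    & \tr (reverse_mx R m *m A) = mu].

Definition MCPM (R : realType) (m : nat) (P : 'M[R]_m) : Prop :=
  [/\ ~~ odd m, is_perm_mx P, P^T = P & \tr P = 0].

(* Main.v *)
Require Import Defs.
From mathcomp Require Import all_boot all_order all_algebra all_fingroup.
From mathcomp Require Import reals lra.

(** The hypothesis on [A] reads [(1 + P) A = c E] or [A (1 + P) = c E], and the
    right-hand side has rank at most 1.  By Sylvester's rank inequality
    [rank A + rank (1 + P) - 2n <= 1], so the bound [rank A <= n + 1] amounts
    to [rank (1 + P) >= n].  Since [P] is a symmetric permutation matrix,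
    [P ^ 2 = P P^T = 1], so [(1 + P) / 2] is a projection; its rank is
    therefore its trace, which is [n] because [tr P = 0]
    ([mxrank_add1_involution]).

    For [n >= 2] singularity follows, as [n + 1 < 2n].  For [n = 1] it comes
    instead from the diagonal conditions: together with the row and column
    sums they force all four entries of [A] to coincide
    ([magic_square2_det0]). *)

Import GRing.Theory Num.Theory.
Local Open Scope ring_scope.

(** In a full-rank factorization [Q = C B], cancelling [C] on the left and [B]
    on the right in [C B C B = C B] leaves [B C = 1], whose size is the rank,
    and [tr (C B) = tr (B C)]. *)
Lemma mxtrace_idempotent (F : fieldType) (m : nat) (Q : 'M[F]_m) :
  Q *m Q = Q -> \tr Q = (\rank Q)%:R.
Proof.
move=> QQ; have CB := mulmx_base Q.
have BC : row_base Q *m col_base Q = 1%:M.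
  apply: (row_free_inj (row_base_free Q)).
  apply: (row_full_inj (col_base_full Q)).
  by rewrite mul1mx -mulmxA CB mulmxA CB.
by rewrite -{1}CB mxtrace_mulC BC mxtrace1.
Qed.

(** [(1 + P) / 2] projects onto the fixed vectors of [P], and its trace is [n].
    The scope [%R] matters: inside [\rank], a bare [+] is the sum of row
    spaces. *)
Lemma mxrank_add1_involution (F : numFieldType) (n : nat) (P : 'M[F]_(2 * n)) :
  P *m P = 1%:M -> \tr P = 0 -> \rank (1%:M + P)%R = n.
Proof.
move=> PP trP.
have two0 : (2 : F) != 0 by rewrite pnatr_eq0.
pose Q := 2^-1 *: (1%:M + P).
have QQ : Q *m Q = Q.
  rewrite /Q -scalemxAl -scalemxAr scalerA mulmxDl mul1mx mulmxDr mulmx1 PP.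
  rewrite [P + _]addrC -mulr2n -scaler_nat scalerA.
  by congr (_ *: _); rewrite -mulrA mulVf // mulr1.
have := mxtrace_idempotent _ _ _ QQ.
rewrite mxtraceZ mxtraceD mxtrace1 trP addr0 natrM mulrA mulVf // mul1r.
rewrite /Q eqmx_scale ?invr_eq0 //.
by move/eqP; rewrite eqr_nat => /eqP.
Qed.

Lemma MCPM_involution (R : realType) (m : nat) (P : 'M[R]_m) :
  MCPM P -> P *m P = 1%:M.
Proof.
case=> _ /is_perm_mxP[s ->] symP _.
by rewrite -{2}symP tr_perm_mx -perm_mxM mulgV perm_mx1.
Qed.

Lemma mxrank_const_mx (F : fieldType) (m p : nat) (a : F) :
  (\rank (const_mx a : 'M[F]_(m, p)) <= 1)%N.
Proof.
have -> : const_mx a = (const_mx a : 'cV_m) *m (const_mx 1 : 'rV[F]_p).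
  by apply/matrixP=> i j; rewrite !mxE big_ord1 !mxE mulr1.
exact: leq_trans (mxrankM_maxl _ _) (rank_leq_col _).
Qed.

(** Writing [a b] and [c d] for the two rows, each of [b], [c] and [d] complements
    [a] to [mu] along a row, a column and a diagonal, so [b = c = d]; the
    other diagonal gives [b + c = mu = a + b], hence [c = a]: the two rows are
    equal. *)
Lemma magic_square2_det0 (R : realType) (mu : R) (A : 'M[R]_2) :
  magic_square mu A -> \det A = 0.
Proof.
case=> rowA colA trA antiA.
have entry i k : ((basis_col R i)^T *m A) 0 k = A i k.
  by rewrite trmx_delta -rowE mxE.
(* Expanding the sums produces the index [lift ord0 ord0], equal to [1] only
   up to its bound proof; hence the [val_inj] steps. *)
have r0 : A 0 0 + A 0 1 = mu.
  by rewrite -(rowA 0) mxE !big_ord_recl big_ord0 !entry !mxE !mulr1 addr0;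
     congr (_ + A _ _); apply: val_inj.
have c0 : A 0 0 + A 1 0 = mu.
  rewrite -(colA 0) -colE mxE mxE !big_ord_recl big_ord0 !mxE !mul1r addr0.
  by congr (_ + A _ _); apply: val_inj.
have d : A 0 0 + A 1 1 = mu.
  rewrite -trA /mxtrace !big_ord_recl big_ord0 addr0.
  by congr (_ + A _ _); apply: val_inj.
have a : A 0 1 + A 1 0 = mu.
  rewrite -antiA /mxtrace !big_ord_recl big_ord0 addr0.
  rewrite !mxE !big_ord_recl !big_ord0 !mxE /= !(mul0r, mul1r, add0r, addr0).
  by rewrite addrC; congr (A _ _ + A _ _); apply: val_inj.
have e1 : A 0 1 = A 0 0 by lra.
have e2 : A 1 0 = A 0 0 by lra.
have e3 : A 1 1 = A 0 0 by lra.
apply: (@determinant_alternate _ _ A 0 1) => // k.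
have [->|->] : k = 0 \/ k = 1.
  by case: k => [[|[|k]] lt_k2] //; [left | right]; apply: val_inj.
- by rewrite e2.
- by rewrite e1 e3.
Qed.

Theorem theorem13 (R : realType) (n : nat) (hn : (0 < n)%N) (mu : R)
    (A : 'M[R]_(2 * n)) (hA : magic_square mu A)
    (hP : exists P : 'M[R]_(2 * n), MCPM P /\
       (A + P *m A = (2 * mu / (2 * n)%:R) *: const_mx 1 \/
        A + A *m P = (2 * mu / (2 * n)%:R) *: const_mx 1)) :
  A \notin unitmx /\ (\rank A <= n + 1)%N.
Proof.
have bound r : (n + r - 2 * n <= 1)%N -> (r <= n + 1)%N.
  by rewrite leq_subLR mul2n -addnn -addnA leq_add2l.
have rkA : (\rank A <= n + 1)%N.
  case: hP => P [mP eqA]; have PP := MCPM_involution _ _ _ mP.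
  case: mP => _ _ _ trP; have rk1P := mxrank_add1_involution _ _ _ PP trP.
  case: eqA => eqA.
  - have := mxrank_mul_min (1%:M + P) A.
    rewrite mulmxDl mul1mx eqA scalemx_const rk1P => le1.
    have := leq_trans le1 (mxrank_const_mx _ _ _ _).
    exact: bound.
  - have := mxrank_mul_min A (1%:M + P).
    rewrite mulmxDr mulmx1 eqA scalemx_const rk1P => le1.
    have := leq_trans le1 (mxrank_const_mx _ _ _ _).
    by rewrite addnC; exact: bound.
split=> //.
case: n hn A hA {hP bound} rkA => [|[|n]] // _ A hA rkA.
  by rewrite unitmxE (magic_square2_det0 _ _ _ hA) unitr0.
rewrite -row_free_unit /row_free neq_ltn; apply/orP; left.
by apply: leq_ltn_trans rkA _; rewrite mul2n -addnn ltn_add2l.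
Qed.
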